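(* Let $\mathcal{A}=\{A_1,\ldots,A_m\}$ be a set of $m$ matrices in $\mathbb{R}^{n\times n}$. Given any positive integer $l$, there exists an explicit path-complete graph $G$ consisting of $m^{l-1}$ nodes assigned to quadratic Lyapunov functions and $m^l$ edges with labels of length one (letters from $\mathcal{A}$) such that the linear matrix inequalities associated with $G$ imply existence of a max-of-quadratics Lyapunov function, and the resulting bound $\hat\rho_{\mathcal{V}^2,G}(\mathcal{A})$ obtained from these linear matrix inequalities satisfies $$\frac{1}{\sqrt[2l]{n}}\,\hat\rho_{\mathcal{V}^2,G}(\mathcal{A})\le\rho(\mathcal{A})\le\hat\rho_{\mathcal{V}^2,G}(\mathcal{A}).$$
   Context: The joint spectral radius is $\rho(\mathcal{A})=\lim_{k\to\infty}\max_{\sigma\in\{1,\ldots,m\}^k}\|A_{\sigma_k}\cdots A_{\sigma_1}\|^{1/k}$. Graphs with labels of length one. The $m$ matrices are regarded as the letters of an alphabet. $G(N,E)$ is a finite directed graph with each edge labeled by a letter; self-loops, and several edges with different labels between the same ordered pair of nodes, are allowed. $G$ is path-complete if for every $k\ge1$ and every $\sigma\in\{1,\ldots,m\}^k$ there is a directed path in $G$ (starting at any node) whose consecutive edge labels are $A_{\sigma_1},\ldots,A_{\sigma_k}$. Associated linear matrix inequalities. For $\gamma>0$, these are, in unknown symmetric matrices $P_i$, $i\in N$: $P_i\succ0$ for all $i\in N$, and $\gamma^2A^TP_jA\preceq P_i$ for every edge of $G$ from node $i$ to node $j$ with label $A\in\mathcal{A}$. $\hat\rho_{\mathcal{V}^2,G}(\mathcal{A})$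 is the infimum of $1/\gamma$ over all $\gamma>0$ for which these inequalities are feasible. ''The linear matrix inequalities imply existence of a max-of-quadratics Lyapunov function'' means: whenever they are feasible for a given $\gamma>0$, there is a function $V(x)=\max\{x^TQ_1x,\ldots,x^TQ_Kx\}$, for finitely many positive definite matrices $Q_1,\ldots,Q_K$, such that $V(\gamma A_ix)\le V(x)$ for all $i=1,\ldots,m$ and all $x\in\mathbb{R}^n$. *)

(* Defs.v *)
From HB Require Import structures.
From mathcomp Require Import all_boot all_order all_algebra.
From mathcomp Require Import all_classical all_reals all_analysis.
Import Order.TTheory GRing.Theory Num.Theory.
Import numFieldNormedType.Exports.

Set Implicit Arguments.
Unset Strict Implicit.
Unset Printing Implicit Defensive.

Local Open Scope classical_set_scope.
Local Open Scope ring_scope.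

Section Matrices.
Context {R : realType} {n : nat}.
Implicit Types (P Q : 'M[R]_n) (x : 'cV[R]_n).

Definition quad P x : R := (x^T *m P *m x) 0 0.

Definition posdefmx P : Prop :=
  P^T = P /\ forall x, x != 0 -> 0 < quad P x.

Definition possemidefmx P : Prop :=
  P^T = P /\ forall x, 0 <= quad P x.

Definition loewner_le P Q : Prop := possemidefmx (Q - P).

(* An arbitrary norm on the vector space of n x n matrices; it need not be
   submultiplicative or induced by a vector norm. *)
Definition is_mxnorm (nrm : 'M[R]_n -> R) : Prop :=
  [/\ forall M N, nrm (M + N) <= nrm M + nrm N,
      forall (c : R) M, nrm (c *: M) = `|c| * nrm M
    & forall M, nrm M = 0 -> M = 0].

End Matrices.

Section JointSpectralRadius.
Context {R : realType} {n m : nat}.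
Variables (nrm : 'M[R]_n -> R) (A : 'I_m -> 'M[R]_n).

(* For s = [:: s_1; ...; s_k] this is A_{s_k} *m ... *m A_{s_1}: the matrix of
   the first letter acts first. *)
Definition mxword (s : seq 'I_m) : 'M[R]_n :=
  foldl (fun M i => A i *m M) 1%:M s.

(* Norms are nonnegative, so the default value 0 of the maximum is harmless;
   the term at k = 0 plays no role in the limit. *)
Definition jsr_seq (k : nat) : R :=
  \big[Num.max/0]_(s : k.-tuple 'I_m) (nrm (mxword s) `^ (k%:R)^-1).

Definition jsr : R := lim (jsr_seq @ \oo).

End JointSpectralRadius.

(* A finite directed graph whose edges are labeled by letters of 'I_m; the
   triple (i, a, j) is the edge from i to j with label a. *)
Record lgraph (m : nat) := LGraph {
  node :> finType;
  edges : {set node * 'I_m * node} }.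

Definition path_complete (m : nat) (G : lgraph m) : Prop :=
  forall (k : nat) (s : k.-tuple 'I_m), (1 <= k)%N ->
    exists v : nat -> G, forall t : 'I_k, (v t, tnth s t, v t.+1) \in edges G.

Section LMI.
Context {R : realType} {n m : nat}.
Variables (G : lgraph m) (A : 'I_m -> 'M[R]_n).

Definition lmi_feasible (gamma : R) : Prop :=
  exists P : G -> 'M[R]_n,
    (forall i, posdefmx (P i)) /\
    forall i a j, (i, a, j) \in edges G ->
      loewner_le (gamma ^+ 2 *: ((A a)^T *m P j *m A a)) (P i).

Definition rho_hat : R :=
  inf [set gamma^-1 | gamma in [set gamma : R | 0 < gamma /\ lmi_feasible gamma]].

Definition max_quad (K : nat) (Q : 'I_K.+1 -> 'M[R]_n) (x : 'cV[R]_n) : R :=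
  \big[Num.max/quad (Q ord0) x]_(i < K.+1) quad (Q i) x.

Definition max_quad_lyapunov (gamma : R) : Prop :=
  exists (K : nat) (Q : 'I_K.+1 -> 'M[R]_n),
    (forall i, posdefmx (Q i)) /\
    forall (i : 'I_m) (x : 'cV[R]_n),
      max_quad Q (gamma *: (A i *m x)) <= max_quad Q x.

Definition lmi_implies_max_quad : Prop :=
  forall gamma : R, 0 < gamma -> lmi_feasible gamma -> max_quad_lyapunov gamma.

End LMI.

(* Main.v *)
Require Import Defs.
From mathcomp Require Import all_boot all_order all_algebra.
From mathcomp Require Import all_classical all_reals all_analysis.
From mathcomp Require Import perm ring lra.
Import Order.TTheory GRing.Theory Num.Theory.
Import numFieldNormedType.Exports.
Local Open Scope ring_scope.

Set Implicit Arguments.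
Unset Strict Implicit.
Unset Printing Implicit Defensive.

(** The graph is a de Bruijn graph: its nodes are the words of length [l - 1],
    a node standing for the letters about to be read ([debruijn]).

    Upper bound on [jsr]. Every node has, for every letter, an incoming edge
    with that letter, so a solution of the linear matrix inequalities makes the
    maximum of its quadratic forms decrease along each [gamma *: A i]
    ([debruijn_max_quad]). This maximum is comparable to the square of a norm;
    iterating the decrease shows that products of length [k] are
    [O(gamma ^ - k)] ([max_quad_lyapunov_growth]), hence [jsr <= gamma^-1].

    Upper bound on [rho_hat]. Let [kappa = n ^ (1 / 2 l)] and [kappa * jsr < rho]; choose
    [q] with [jsr < q < rho / kappa]. The supremum of [|A_s x| / q ^ |s|] over
    all words [s] is a norm [N] for which each letter has operator norm at most
    [q] ([growth_norm_word]). For every [K > n], the ellipsoid of almost maximal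
    volume in the unit ball of [N] gives a quadratic form [Q] with
    [N ^ 2 <= Q <= K * N ^ 2] ([loewner_john]). Along a word of length [l] the
    form [Q] thus grows by at most [K * q ^ (2 l)], and this is [rho ^ (2 l)]
    for [K = (rho / q) ^ (2 l)], which exceeds [kappa ^ (2 l) = n]. A common
    quadratic Lyapunov function for the words of length [l] turns into a
    solution on the graph by summing it along the letters that each node
    announces ([debruijn_feasible]), so [rho_hat <= rho].

    Both halves speak of [jsr] through the exponential rates that bound all
    products: [jsr] is the infimum of these rates, for every norm ([jsr_inf]).
    The limit exists because a bound on the products of one length propagates
    to all lengths, and it does not depend on the norm because all norms on
    matrices are equivalent. *)

(** * The entrywise l1 norm *)

Section L1Norm.
Context {R : realType}.

(** Unlike the entrywise maximum, this norm is submultiplicative for products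
    of all formats, so it serves for vectors and matrices alike. *)
Definition l1norm {m n : nat} (M : 'M[R]_(m, n)) : R :=
  \sum_i \sum_j `|M i j|.

Lemma l1norm_ge0 m n (M : 'M[R]_(m, n)) : 0 <= l1norm M.
Proof. by apply: sumr_ge0 => i _; apply: sumr_ge0. Qed.

Lemma ler_l1normD m n (M N : 'M[R]_(m, n)) :
  l1norm (M + N) <= l1norm M + l1norm N.
Proof.
rewrite -big_split; apply: ler_sum => i _ /=; rewrite -big_split.
by apply: ler_sum => j _; rewrite mxE; exact: ler_normD.
Qed.

Lemma l1normZ m n (c : R) (M : 'M[R]_(m, n)) : l1norm (c *: M) = `|c| * l1norm M.
Proof.
rewrite mulr_sumr; apply: eq_bigr => i _; rewrite mulr_sumr.
by apply: eq_bigr => j _; rewrite mxE normrM.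
Qed.

Lemma ler_entry_l1norm m n (M : 'M[R]_(m, n)) i j : `|M i j| <= l1norm M.
Proof.
rewrite /l1norm (bigD1 i) //= (bigD1 j) //= -addrA lerDl addr_ge0 //.
  by apply: sumr_ge0.
by apply: sumr_ge0 => k _; apply: sumr_ge0.
Qed.

Lemma ler_l1normM m n p (M : 'M[R]_(m, n)) (N : 'M[R]_(n, p)) :
  l1norm (M *m N) <= l1norm M * l1norm N.
Proof.
rewrite mulr_suml; apply: ler_sum => i _.
apply: (@le_trans _ _ (\sum_j \sum_k `|M i k| * `|N k j|)).
  apply: ler_sum => j _; rewrite mxE.
  by apply: le_trans (ler_norm_sum _ _ _) _; under eq_bigr do rewrite normrM.
rewrite exchange_big mulr_suml; apply: ler_sum => k _ /=.
rewrite -mulr_sumr; apply: ler_wpM2l => //.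
rewrite /l1norm (bigD1 k) //= lerDl.
by apply: sumr_ge0 => i' _; apply: sumr_ge0.
Qed.

(** The columns of [M] are the images of the basis vectors, of norm 1; adding
    them up costs the factor [n]. *)
Lemma l1norm_le_vect m n (M : 'M[R]_(m, n)) (c : R) :
  (forall x : 'cV[R]_n, l1norm (M *m x) <= c * l1norm x) -> l1norm M <= n%:R * c.
Proof.
move=> bM; have -> : l1norm M = \sum_j l1norm (M *m delta_mx j (0 : 'I_1)).
  rewrite /l1norm exchange_big /=; apply: eq_bigr => j _.
  by apply: eq_bigr => i _; rewrite big_ord1 -colE mxE.
have -> : n%:R * c = \sum_(j < n) c by rewrite sumr_const card_ord mulr_natl.
apply: ler_sum => j _; apply: le_trans (bM _) _.
have -> : l1norm (delta_mx j (0 : 'I_1) : 'cV[R]_n) = 1; last by rewrite mulr1.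
rewrite /l1norm (bigD1 j) //= big_ord1 mxE !eqxx normr1 big1 ?addr0 // => i ij.
by rewrite big_ord1 mxE (negPf ij) normr0.
Qed.

End L1Norm.

(** * Equivalence of norms on matrices *)

Section NormEquivalence.
Context {R : realType} {n : nat}.
Variable nrm : 'M[R]_n -> R.
Hypothesis nrmP : is_mxnorm nrm.

Let nrmD M N : nrm (M + N) <= nrm M + nrm N. Proof. by case: nrmP. Qed.
Let nrmZ c M : nrm (c *: M) = `|c| * nrm M. Proof. by case: nrmP. Qed.
Let nrm0_eq0 M : nrm M = 0 -> M = 0. Proof. by case: nrmP => _ _; apply. Qed.

Lemma mxnorm0 : nrm 0 = 0.
Proof. by rewrite -(scale0r 0) nrmZ normr0 mul0r. Qed.

Lemma mxnormN M : nrm (- M) = nrm M.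
Proof. by rewrite -scaleN1r nrmZ normrN1 mul1r. Qed.

Lemma mxnorm_ge0 M : 0 <= nrm M.
Proof. by have := nrmD M (- M); rewrite subrr mxnorm0 mxnormN; lra. Qed.

Lemma mxnorm_le_l1norm : exists2 C, 0 < C & forall M, nrm M <= C * l1norm M.
Proof.
pose C := 1 + \sum_i \sum_j nrm (delta_mx i j).
have C_ge i j : nrm (delta_mx i j) <= C.
  rewrite /C (bigD1 i) //= (bigD1 j) //=.
  have h1 : 0 <= \sum_(k | k != j) nrm (delta_mx i k).
    by apply: sumr_ge0 => k _; exact: mxnorm_ge0.
  have h2 : 0 <= \sum_(h | h != i) \sum_k nrm (delta_mx h k).
    by apply: sumr_ge0 => h _; apply: sumr_ge0 => k _; exact: mxnorm_ge0.
  lra.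
exists C.
  apply: ltr_pwDl => //.
  by apply: sumr_ge0 => h _; apply: sumr_ge0 => k _; exact: mxnorm_ge0.
have nrm_sum (I : finType) (F : I -> 'M[R]_n) : nrm (\sum_i F i) <= \sum_i nrm (F i).
  elim/big_ind2: _ => [|M a N b Ma Nb|//]; first by rewrite mxnorm0.
  exact: le_trans (nrmD _ _) (lerD Ma Nb).
move=> M; rewrite {1}[M]matrix_sum_delta.
apply: le_trans (nrm_sum _ _) _; rewrite mulr_sumr; apply: ler_sum => i _.
apply: le_trans (nrm_sum _ _) _; rewrite mulr_sumr; apply: ler_sum => j _.
by rewrite nrmZ mulrC ler_wpM2r.
Qed.

(** A norm is Lipschitz, hence continuous, and so attains a minimum on the
    compact unit sphere; as the norm is definite this minimum is positive. *)
Lemma l1norm_le_mxnorm : exists2 D, 0 < D & forall M, l1norm M <= D * nrm M.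
Proof.
have [C C0 nrmC] := mxnorm_le_l1norm.
(* In dimension 0 there is no unit sphere to minimise on. *)
case: n nrm nrmD nrmZ nrm0_eq0 C C0 nrmC mxnorm_ge0 => [|p] N ND NZ N0 C C0 NC Nge0.
  by exists 1 => // M; rewrite /l1norm big_ord0 mul1r.
pose d := (p.+1 * p.+1)%N.
have entry_le (v : 'rV[R]_d) k : `|v 0 k| <= `|v|.
  rewrite [leRHS]/Num.norm /= mx_normrE.
  by apply/bigmax_geP; right; exists (0, k).
have l1le (v : 'rV[R]_d) : l1norm (vec_mx v : 'M[R]_(p.+1)) <= d%:R * `|v|.
  have -> : d%:R * `|v| = \sum_(i < p.+1) \sum_(j < p.+1) `|v|.
    by rewrite !sumr_const !card_ord -mulrnA mulr_natl.
  by apply: ler_sum => i _; apply: ler_sum => j _; rewrite mxE.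
pose f (v : 'rV[R]_d) := N (vec_mx v).
have fC u v : `|f u - f v| <= C * d%:R * `|u - v|.
  have h a b : f a - f b <= C * d%:R * `|a - b|.
    rewrite lerBlDr -{1}(subrK b a) /f linearD.
    apply: le_trans (ND _ _) _; rewrite lerD2r.
    by apply: le_trans (NC _) _; rewrite -mulrA ler_wpM2l ?l1le ?ltW.
  rewrite ler_norml h andbT lerNl opprB; apply: le_trans (h _ _) _.
  by rewrite distrC.
have f_cont : continuous f.
  move=> v; apply/(@cvgrPdist_le _ _ _ (nbhs v)) => e e0; near=> u.
  apply: le_trans (fC _ _) _; rewrite -ler_pdivlMl; last first.
    by rewrite mulr_gt0 // ltr0n.
  near: u; apply: (@cvgr_dist_le _ _ _ (nbhs v) _ id); first exact: cvg_id.
  by rewrite mulr_gt0 // invr_gt0 mulr_gt0 // ltr0n.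
pose S : set 'rV[R]_d := [set v | `|v| = 1]%classic.
have S_compact : compact S.
  apply: bounded_closed_compact.
    by exists 1; split; [exact: num_real | move=> x x1 v /= ->; rewrite ltW].
  have -> : S = (Num.norm @^-1` [set 1%R])%classic by [].
  apply: closed_comp; last exact: closed_eq.
  by move=> v _; exact: norm_continuous.
have S_neq0 : (S !=set0)%classic.
  have w0 : (const_mx 1 : 'rV[R]_d) != 0.
    by apply/negP => /eqP /matrixP /(_ 0 0); rewrite !mxE => /eqP; rewrite oner_eq0.
  exists (`|const_mx 1 : 'rV[R]_d|^-1 *: const_mx 1); rewrite /S /= normrZ.
  by rewrite normfV normr_id mulVf // normr_eq0.
have [v vS vmin] := EVT_min_rV S_neq0 S_compact (continuous_subspaceT f_cont).
have {vS} v1 : `|v| = 1 by move: vS; rewrite inE.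
have fv0 : 0 < f v.
  rewrite lt_neqAle Nge0 andbT; apply/negP => /eqP/esym/N0 v0.
  have /eqP : v = 0 by rewrite -[v]vec_mxK v0 linear0.
  by rewrite -normr_eq0 v1 oner_eq0.
exists (d%:R / f v); first by rewrite divr_gt0 // ltr0n.
move=> M; rewrite -{1}[M]mxvecK; apply: le_trans (l1le _) _.
rewrite -mulrA ler_wpM2l // ler_pdivlMl //.
have [->|M0] := eqVneq (mxvec M) 0; first by rewrite normr0 mulr0.
set c := `|mxvec M|; have c0 : 0 < c by rewrite normr_gt0.
have /vmin : (c^-1 *: mxvec M \in S)%classic.
  by rewrite inE /S /= normrZ normfV normr_id mulVf // gt_eqF.
have -> : f (c^-1 *: mxvec M) = c^-1 * N M.
  by rewrite /f linearZ /= mxvecK NZ gtr0_norm // invr_gt0.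
by rewrite ler_pdivlMl // mulrC.
Unshelve. all: by end_near.
Qed.

End NormEquivalence.

(** * Exponential growth rates of matrix products *)

Section Growth.
Context {R : realType} {n m : nat}.
Variable A : 'I_m -> 'M[R]_n.

Lemma mxword_cat s t : mxword A (s ++ t) = mxword A t *m mxword A s.
Proof.
elim/last_ind: t => [|t a IHt]; first by rewrite cats0 mul1mx.
by rewrite -rcons_cat /mxword !foldl_rcons -!/(mxword A _) IHt mulmxA.
Qed.

Lemma mxword_cons a s : mxword A (a :: s) = mxword A s *m A a.
Proof. by rewrite -cat1s mxword_cat /= /mxword /= mulmx1. Qed.

Definition word_growth (q : R) : Prop :=
  exists C : R, forall s, l1norm (mxword A s) <= C * q ^+ size s.

Lemma word_growth_ge0_cst q : word_growth q ->
  exists2 C, 0 <= C & forall s, l1norm (mxword A s) <= C * q ^+ size s.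
Proof.
move=> [C AC]; exists C => //; apply: le_trans (l1norm_ge0 _) _.
by have := AC [::]; rewrite mulr1; exact.
Qed.

Lemma word_growth_le q q' : 0 <= q <= q' -> word_growth q -> word_growth q'.
Proof.
move=> /andP[q0 qq'] /word_growth_ge0_cst[C C0 AC]; exists C => s.
by apply: le_trans (AC s) _; rewrite ler_wpM2l // lerXn2r // nnegrE (le_trans q0).
Qed.

Lemma word_growth_letters q : (forall a, l1norm (A a) <= q) -> word_growth q.
Proof.
move=> Aq; exists (l1norm (1%:M : 'M[R]_n)); elim/last_ind => [|s a IHs].
  by rewrite mulr1.
rewrite -cats1 mxword_cat size_cat addn1 exprS mulrCA.
apply: le_trans (ler_l1normM _ _) _.
by rewrite ler_pM ?l1norm_ge0 // /mxword /= mulmx1.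
Qed.

Lemma word_growth_ex : exists2 q, 0 < q & word_growth q.
Proof.
exists (1 + \sum_a l1norm (A a)).
  by rewrite ltr_pwDl // sumr_ge0 // => a _; exact: l1norm_ge0.
apply: word_growth_letters => a; rewrite (bigD1 a) //= addrCA lerDl.
by rewrite addr_ge0 // sumr_ge0 // => b _; exact: l1norm_ge0.
Qed.

(** By submultiplicativity a bound on the words of one single length [k]
    propagates to all words: cut a word in blocks of length [k], and bound the
    remaining block of length less than [k] by a constant. *)
Lemma word_growth_level k q : (0 < k)%N -> 0 < q ->
  (forall s, size s = k -> l1norm (mxword A s) <= q ^+ k) -> word_growth q.
Proof.
move=> k0 q0 Aq; have [p p0 /word_growth_ge0_cst[C C0 AC]] := word_growth_ex.
(* [p] is some rate valid for all words; a word shorter than [k] exceeds the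
   rate [q] at most by the factor [B ^+ k]. *)
pose B := Num.max 1 (p / q); have B1 : 1 <= B by rewrite le_max lexx.
have pBq : p <= B * q by rewrite -ler_pdivrMr // le_max lexx orbT.
exists (C * B ^+ k) => s; move: {2}(size s) (leqnn (size s)) => N.
elim: N s => [|N IHN] s sN.
  move: sN; rewrite leqn0 => /nilP ->; rewrite mulr1.
  apply: le_trans (AC [::]) _; rewrite mulr1 ler_peMr //.
  exact: exprn_ege1.
have [sk|ks] := ltnP (size s) k.
  apply: le_trans (AC s) _; rewrite -mulrA ler_wpM2l //.
  apply: (@le_trans _ _ ((B * q) ^+ size s)).
    by rewrite lerXn2r // nnegrE ?(ltW p0) // (le_trans (ltW p0)).
  rewrite exprMn ler_wpM2r ?exprn_ge0 ?(ltW q0) //.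
  by rewrite ler_weXn2l // ltnW.
rewrite -{1}(cat_take_drop k s) mxword_cat.
have tk : size (take k s) = k by apply: size_takel.
have -> : size s = (size (drop k s) + k)%N by rewrite size_drop subnK.
rewrite exprD mulrA; apply: le_trans (ler_l1normM _ _) _.
apply: ler_pM; rewrite ?l1norm_ge0 ?Aq //; apply: IHN.
by rewrite size_drop leq_subLR (leq_trans sN) // -add1n leq_add2r.
Qed.

End Growth.

(** * The joint spectral radius as the infimum of the growth rates *)

Section JointSpectralRadius.
Local Open Scope classical_set_scope.
Local Open Scope ring_scope.
Context {R : realType} {n m : nat}.
Variables (nrm : 'M[R]_n -> R) (A : 'I_m -> 'M[R]_n).
Hypothesis nrmP : is_mxnorm nrm.

Lemma jsr_seq_ge0 k : 0 <= jsr_seq nrm A k.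
Proof. by apply/bigmax_geP; left. Qed.

Lemma jsr_seq_le k y : (0 < k)%N -> 0 <= y ->
  (jsr_seq nrm A k <= y) <->
  (forall s : k.-tuple 'I_m, nrm (mxword A s) <= y ^+ k).
Proof.
move=> k0 y0; have k_neq0 : k%:R != 0 :> R by rewrite pnatr_eq0 -lt0n.
have rootE x : 0 <= x -> (x `^ k%:R^-1 <= y) = (x <= y ^+ k).
  move=> x0; apply/idP/idP => h.
    have -> : x = (x `^ k%:R^-1) ^+ k.
      by rewrite -powR_mulrn ?powR_ge0 // -powRrM mulVf // powRr1.
    by rewrite lerXn2r // nnegrE powR_ge0.
  have -> : y = (y ^+ k) `^ k%:R^-1.
    by rewrite -powR_mulrn // -powRrM mulfV // powRr1.
  by apply: ge0_ler_powR; rewrite ?nnegrE ?invr_ge0 ?ler0n ?exprn_ge0.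
split=> [/bigmax_leP[_ h] s|h].
  by rewrite -rootE ?h // mxnorm_ge0.
apply/bigmax_leP; split => // s _.
by rewrite rootE ?h // mxnorm_ge0.
Qed.

(** Constant factors do not affect exponential rates. *)
Lemma scaled_expr_eventually_le (B y z : R) : 0 <= y < z ->
  \forall k \near \oo, B * y ^+ k <= z ^+ k.
Proof.
move=> /andP[y0 yz]; have z0 : 0 < z by exact: le_lt_trans yz.
have B0 : 0 < `|B| + 1 by rewrite ltr_wpDl.
have yz1 : `|y / z| < 1.
  by rewrite ger0_norm ?ltr_pdivrMr ?mul1r // divr_ge0 // ltW.
have /cvgr0Pnorm_le/(_ (`|B| + 1)^-1) := cvg_expr yz1.
rewrite invr_gt0 => /(_ B0); apply: filterS => k.
rewrite normrX ger0_norm ?divr_ge0 ?(ltW z0) // expr_div_n.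
rewrite ler_pdivrMr ?exprn_gt0 // ler_pdivlMl //; apply: le_trans.
rewrite ler_wpM2r ?exprn_ge0 //; apply: le_trans (ler_norm B) _; lra.
Qed.

Let rates : set R := [set q | 0 < q /\ word_growth A q].

Let rates_has_inf : has_inf rates.
Proof.
split; last by exists 0 => q [/ltW].
by have [q q0 Aq] := word_growth_ex A; exists q.
Qed.

(** The upper bound holds since [nrm] is dominated by [l1norm]. For the lower
    bound, a value of the sequence below the infimum at a large length [k]
    would, as [l1norm] is dominated by [nrm], bound all words of length [k] at
    a rate still below the infimum, against [word_growth_level]. *)
Lemma jsr_seq_cvg : jsr_seq nrm A @ \oo --> inf rates.
Proof.
have [[q1 q1P] rates_lb] := rates_has_inf.
have inf0 : 0 <= inf rates by apply: lb_le_inf; [exists q1 | move=> q [/ltW]].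
have [C C0 nrmC] := mxnorm_le_l1norm nrmP.
have [D D0 nrmD] := l1norm_le_mxnorm nrmP.
apply/cvgrPdist_le => e e0.
have [q [q0 /word_growth_ge0_cst[B B0 AB]] qe] := inf_adherent e0 rates_has_inf.
have upper : \forall k \near \oo, jsr_seq nrm A k <= inf rates + e.
  have qq : 0 <= q < inf rates + e by rewrite ltW.
  near=> k.
  have k0 : (0 < k)%N by near: k; exact: nbhs_infty_gt.
  apply/jsr_seq_le => //; first by rewrite addr_ge0 // ltW.
  move=> s; apply: le_trans (nrmC _) _.
  apply: (@le_trans _ _ ((C * B) * q ^+ k)); last first.
    by near: k; exact: scaled_expr_eventually_le.
  by rewrite -mulrA ler_wpM2l ?(ltW C0) //; have := AB s; rewrite size_tuple.
have lower : \forall k \near \oo, inf rates - e <= jsr_seq nrm A k.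
  have [r_le|r_gt] := leP (inf rates - e) 0.
    by near=> k; apply: le_trans r_le (jsr_seq_ge0 _).
  have rr : 0 <= inf rates - e < inf rates - e / 2 by lra.
  near=> k.
  have k0 : (0 < k)%N by near: k; exact: nbhs_infty_gt.
  rewrite leNgt; apply/negP => /ltW /(jsr_seq_le k0 (ltW r_gt)) small.
  have : rates (inf rates - e / 2).
    split; first lra.
    apply: (word_growth_level k0); first lra.
    move=> s sk; apply: le_trans (nrmD _) _.
    apply: (@le_trans _ _ (D * (inf rates - e) ^+ k)).
      have sk' : size s == k by rewrite sk.
      by rewrite ler_wpM2l ?(ltW D0) //; exact: (small (Tuple sk')).
    by near: k; exact: scaled_expr_eventually_le.
  move=> /(ge_inf rates_lb); lra.
near=> k; rewrite ler_norml; apply/andP; split.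
  suff : jsr_seq nrm A k <= inf rates + e by lra.
  by near: k.
suff : inf rates - e <= jsr_seq nrm A k by lra.
by near: k.
Unshelve. all: by end_near.
Qed.

Lemma jsr_inf : jsr nrm A = inf rates.
Proof. exact/cvg_lim/jsr_seq_cvg. Qed.

Lemma jsr_ge0 : 0 <= jsr nrm A.
Proof. by rewrite jsr_inf; apply: lb_le_inf; [case: rates_has_inf | move=> q [/ltW]]. Qed.

Lemma jsr_le_growth q : 0 < q -> word_growth A q -> jsr nrm A <= q.
Proof. by move=> q0 Aq; rewrite jsr_inf; apply: ge_inf; [case: rates_has_inf | ]. Qed.

Lemma growth_of_jsr_lt q : jsr nrm A < q -> word_growth A q.
Proof.
rewrite jsr_inf => /(inf_lt (proj1 rates_has_inf)) [q' [q'0 Aq'] q'q].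
by apply: word_growth_le Aq'; rewrite !ltW.
Qed.

End JointSpectralRadius.

(** * Quadratic forms *)

Section QuadraticForms.
Context {R : realType} {n : nat}.
Implicit Types (P Q M : 'M[R]_n) (x y : 'cV[R]_n).

Lemma quad_congr M P x : quad (M^T *m P *m M) x = quad P (M *m x).
Proof. by rewrite /quad trmx_mul !mulmxA. Qed.

Lemma quadDl P Q x : quad (P + Q) x = quad P x + quad Q x.
Proof. by rewrite /quad mulmxDr mulmxDl mxE. Qed.

Lemma quadZl c P x : quad (c *: P) x = c * quad P x.
Proof. by rewrite /quad -scalemxAr -scalemxAl mxE. Qed.

Lemma quadNl P x : quad (- P) x = - quad P x.
Proof. by rewrite -scaleN1r quadZl mulN1r. Qed.

Lemma quad_sum (I : Type) (r : seq I) (F : I -> 'M[R]_n) x :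
  quad (\sum_(i <- r) F i) x = \sum_(i <- r) quad (F i) x.
Proof.
elim/big_rec2: _ => [|i a b _ <-]; first by rewrite /quad mulmx0 mul0mx mxE.
by rewrite quadDl.
Qed.

Lemma quadZr c P x : quad P (c *: x) = c ^+ 2 * quad P x.
Proof.
rewrite /quad; have -> : (c *: x)^T = c *: x^T by rewrite linearZ.
by rewrite -scalemxAr -!scalemxAl scalerA mxE expr2.
Qed.

Lemma quad_addZ P x y t : quad P (x + t *: y) =
  quad P x + t * ((x^T *m P *m y) 0 0 + (y^T *m P *m x) 0 0) + t ^+ 2 * quad P y.
Proof.
rewrite -quadZr /quad.
have -> : (x + t *: y)^T = x^T + (t *: y)^T by rewrite linearD.
rewrite mulmxDl mulmxDl !mulmxDr.
have -> : (t *: y)^T = t *: y^T by rewrite linearZ.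
rewrite -!scalemxAl -!scalemxAr !mxE; ring.
Qed.

Lemma quad1E x : quad 1%:M x = \sum_i x i 0 ^+ 2.
Proof. by rewrite /quad mulmx1 mxE; apply: eq_bigr => i _; rewrite mxE expr2. Qed.

Lemma quad1_ge0 x : 0 <= quad 1%:M x.
Proof. by rewrite quad1E sumr_ge0 // => i _; exact: sqr_ge0. Qed.

Lemma quad1_gt0 x : x != 0 -> 0 < quad 1%:M x.
Proof.
move=> x0; rewrite lt_neqAle quad1_ge0 andbT eq_sym; apply: contraNneq x0 => q0.
apply/eqP/colP => i; rewrite mxE; apply/eqP; rewrite -sqrf_eq0; apply/eqP/le_anti.
rewrite sqr_ge0 andbT -q0 quad1E (bigD1 i) //= lerDl sumr_ge0 // => j _.
exact: sqr_ge0.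
Qed.

Lemma posdef_ge0 P x : posdefmx P -> 0 <= quad P x.
Proof.
move=> [_ P0]; have [->|/P0/ltW //] := eqVneq x 0.
by rewrite /quad mulmx0 mxE.
Qed.

Lemma quad_l1norm_ub P x : quad P x <= l1norm P * l1norm x ^+ 2.
Proof.
have l1T : l1norm x^T = l1norm x.
  rewrite /l1norm exchange_big; apply: eq_bigr => i _.
  by apply: eq_bigr => j _; rewrite mxE.
apply: le_trans (ler_norm _) _; apply: le_trans (ler_entry_l1norm _ _ _) _.
apply: le_trans (ler_l1normM _ _) _.
apply: (@le_trans _ _ (l1norm x^T * l1norm P * l1norm x)).
  by rewrite ler_wpM2r ?l1norm_ge0 // ler_l1normM.
by rewrite l1T mulrAC mulrC expr2.
Qed.

Lemma posdef_unitmx P : posdefmx P -> P \in unitmx.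
Proof.
move=> [PT P0]; rewrite unitmxE unitfE; apply/det0P => -[v v0 vP].
have /P0 : v^T != 0 by rewrite trmx_eq0.
by rewrite /quad trmxK vP mul0mx mxE ltxx.
Qed.

(** The coordinate [x i] is the scalar product, for the form [P], of [x] with
    [P^-1 e_i]; Cauchy-Schwarz bounds it by the square root of [quad P x]. *)
Lemma posdef_l1norm_lb P : posdefmx P ->
  exists2 c, 0 <= c & forall x, l1norm x <= c * Num.sqrt (quad P x).
Proof.
move=> Ppos; have [PT Pgt0] := Ppos.
pose w i : 'cV[R]_n := invmx P *m delta_mx i 0.
have xiE x i : ((w i)^T *m P *m x) 0 0 = x i 0.
  have -> : (w i)^T *m P = delta_mx 0 i.
    rewrite trmx_mul trmx_inv PT trmx_delta -mulmxA mulVmx ?mulmx1 //.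
    exact: posdef_unitmx.
  by rewrite -rowE mxE.
have CS x i : x i 0 ^+ 2 <= quad P (w i) * quad P x.
  have [-> | x0] := eqVneq x 0.
    by rewrite mxE expr0n /= mulr_ge0 // posdef_ge0.
  (* [t] minimises the nonnegative polynomial [quad P (w i + t *: x)]. *)
  have qx := Pgt0 _ x0; pose t := - x i 0 / quad P x.
  have := posdef_ge0 (w i + t *: x) Ppos.
  have -> : quad P (w i + t *: x) =
      quad P (w i) + 2 * t * x i 0 + t ^+ 2 * quad P x.
    have sym : (x^T *m P *m w i) 0 0 = x i 0.
      transitivity ((x^T *m P *m w i)^T 0 0); first by rewrite [RHS]mxE.
      by rewrite (trmx_mul _ (w i)) (trmx_mul x^T) trmxK PT mulmxA xiE.
    rewrite quad_addZ sym xiE.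
    ring.
  have -> : quad P (w i) + 2 * t * x i 0 + t ^+ 2 * quad P x =
            quad P (w i) - x i 0 ^+ 2 / quad P x.
    by rewrite /t; field; rewrite gt_eqF.
  by rewrite subr_ge0 ler_pdivrMr.
exists (\sum_i Num.sqrt (quad P (w i))); first exact: sumr_ge0.
move=> x; rewrite mulr_suml; apply: ler_sum => i _; rewrite big_ord1.
by rewrite -sqrtrM ?posdef_ge0 // -sqrtr_sqr ler_wsqrtr.
Qed.

End QuadraticForms.

(** * Max-of-quadratics Lyapunov functions bound the growth *)

Section Lyapunov.
Context {R : realType} {n m : nat}.
Variable A : 'I_m -> 'M[R]_n.

(** A max-of-quadratics function is equivalent to the square of a norm, and its
    decrease along [gamma *: A i] iterates along words. *)
Lemma max_quad_lyapunov_growth gamma : 0 < gamma ->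
  max_quad_lyapunov A gamma -> word_growth A gamma^-1.
Proof.
move=> g0 [K [Q [Qpos VA]]].
have [c c0 lb] := posdef_l1norm_lb (Qpos ord0).
pose L := \sum_i l1norm (Q i).
have L0 : 0 <= L by apply: sumr_ge0 => i _; exact: l1norm_ge0.
have VL x : max_quad Q x <= L * l1norm x ^+ 2.
  have QL i : quad (Q i) x <= L * l1norm x ^+ 2.
    apply: le_trans (quad_l1norm_ub _ _) _; rewrite ler_wpM2r ?sqr_ge0 //.
    by rewrite /L (bigD1 i) //= lerDl sumr_ge0 // => j _; exact: l1norm_ge0.
  by apply/bigmax_leP; split.
have Vword s x : max_quad Q (gamma ^+ size s *: (mxword A s *m x)) <= max_quad Q x.
  elim/last_ind: s => [|s a IHs]; first by rewrite scale1r mul1mx.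
  rewrite -cats1 mxword_cat size_cat addn1 exprS -scalerA -mulmxA.
  by rewrite {1}/mxword /= mulmx1 scalemxAr (le_trans (VA _ _)).
exists (n%:R * (c * Num.sqrt L)) => s; rewrite -mulrA; apply: l1norm_le_vect => x.
rewrite mulrAC exprVn ler_pdivlMr ?exprn_gt0 // mulrC.
rewrite -[X in X * _](gtr0_norm (exprn_gt0 _ g0)) -l1normZ.
apply: le_trans (lb _) _; rewrite -mulrA ler_wpM2l //.
rewrite -[X in _ * X](ger0_norm (l1norm_ge0 _)) -sqrtr_sqr -sqrtrM //.
apply: ler_wsqrtr; apply: le_trans (VL x); apply: le_trans (Vword s x).
by apply/bigmax_geP; left.
Qed.

End Lyapunov.

(** * Rank-one updates of scalar matrices *)

Section RankOneUpdate.
Context {R : realType}.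

(** Two block-triangular factors, multiplied in both orders, have the two sides
    as determinants. *)
Lemma det1D_rank1 n (u : 'cV[R]_n) (v : 'rV[R]_n) :
  \det (1%:M + u *m v) = 1 + (v *m u) 0 0.
Proof.
have E : block_mx 1%:M (- v) u 1%:M *m block_mx 1%:M v 0 1%:M =
         block_mx (1%:M : 'M[R]_1) 0 u (1%:M + u *m v).
  by rewrite mulmx_block !mulmx1 !mul1mx !mulmx0 !addr0 subrr addrC.
have F : block_mx 1%:M v 0 1%:M *m block_mx 1%:M (- v) u 1%:M =
         block_mx ((1%:M : 'M[R]_1) + v *m u) 0 u 1%:M.
  by rewrite mulmx_block !mulmx1 !mul1mx !mul0mx !add0r addNr.
have := congr1 determinant E; rewrite !det_mulmx det_lblock det1 mul1r => <-.
rewrite mulrC -det_mulmx F det_lblock det1 mulr1 det_mx11.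
by rewrite !mxE.
Qed.

Lemma det_scalarD_rank1 n (a : R) (u : 'cV[R]_n.+1) (v : 'rV[R]_n.+1) : a != 0 ->
  \det (a%:M + u *m v) = a ^+ n * (a + (v *m u) 0 0).
Proof.
move=> a0; have -> : a%:M + u *m v = a *: (1%:M + (a^-1 *: u) *m v).
  by rewrite scalerDr scalemx1 -scalemxAl scalerA mulfV // scale1r.
rewrite detZ det1D_rank1 -scalemxAr mxE exprSr -mulrA mulrDr mulr1 mulrA mulfV //.
by rewrite mul1r.
Qed.

(** The symmetric square root of [(1 - t) I + t z z^T]: it acts as a scalar on
    the orthogonal of [z] and as another scalar on the line of [z]. *)
Lemma rank1_update_sqrt n (z : 'cV[R]_n) (t : R) : 0 <= t <= 1 -> 0 < quad 1%:M z ->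
  exists2 S : 'M[R]_n, S^T = S & S *m S = (1 - t)%:M + t *: (z *m z^T).
Proof.
move=> /andP[t0 t1] z0; set r := quad 1%:M z in z0 *.
have rE : z^T *m z = r%:M by rewrite [LHS]mx11_scalar /r /quad mulmx1.
(* The eigenvalues of [S]: [a] on the orthogonal of [z], [b] on its line. *)
pose a := Num.sqrt (1 - t); pose b := Num.sqrt (1 - t + t * r).
have a2 : a ^+ 2 = 1 - t by rewrite sqr_sqrtr // subr_ge0.
have b2 : b ^+ 2 = 1 - t + t * r.
  by rewrite sqr_sqrtr // addr_ge0 ?subr_ge0 // mulr_ge0 // ltW.
pose c := (b - a) / r.
have cr : c * r = b - a by rewrite /c mulfVK // gt_eqF.
exists (a%:M + c *: (z *m z^T)).
  rewrite linearD /= tr_scalar_mx; congr (_ + _).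
  by rewrite linearZ /= trmx_mul trmxK.
rewrite mulmxDl !mulmxDr !mul_scalar_mx mul_mx_scalar scale_scalar_mx.
rewrite -!scalemxAl -!scalemxAr -(mulmxA z) (mulmxA z^T) rE mul_scalar_mx.
rewrite -scalemxAr !scalerA -addrA -!scalerDl -a2 expr2; congr (_ + _ *: _).
have : (a + c * r) ^+ 2 = b ^+ 2 by rewrite cr addrC subrK.
rewrite b2 -a2 sqrrD -addrA => /addrI h.
apply: (mulIf (lt0r_neq0 z0)); rewrite -h; ring.
Qed.

End RankOneUpdate.

(** * Ellipsoids approximating the unit ball of a norm *)

Section LoewnerJohn.
Context {R : realType} {n : nat}.
Variable N : 'cV[R]_n.+1 -> R.
Hypothesis N_D : forall x y, N (x + y) <= N x + N y.
Hypothesis N_Z : forall c x, N (c *: x) = `|c| * N x.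
Hypothesis N_lb : forall x, l1norm x <= N x.
Variable C : R.
Hypothesis N_ub : forall x, N x <= C * l1norm x.

Let N_ge0 x : 0 <= N x.
Proof. exact: le_trans (l1norm_ge0 _) (N_lb x). Qed.

(** An ellipsoid in the unit ball of [N] is encoded by any matrix sending the
    Euclidean unit ball onto it: no positivity constraint is involved, and the
    volume is measured by [(\det M) ^+ 2]. *)
Definition inscribed (M : 'M[R]_n.+1) : Prop :=
  forall u, N (M *m u) ^+ 2 <= quad 1%:M u.

Lemma inscribed_ex : exists2 M, inscribed M & 0 < (\det M) ^+ 2.
Proof.
have C0 : 0 < `|C| + 1 by rewrite ltr_wpDl.
pose c := ((`|C| + 1) * n.+1%:R)^-1.
have c0 : 0 < c by rewrite invr_gt0 mulr_gt0 // ltr0n.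
exists c%:M; last by rewrite det_scalar -exprM exprn_gt0.
move=> u; rewrite mul_scalar_mx N_Z gtr0_norm //.
have l1u : l1norm u <= n.+1%:R * Num.sqrt (quad 1%:M u).
  have -> : n.+1%:R * Num.sqrt (quad 1%:M u) = \sum_(i < n.+1) Num.sqrt (quad 1%:M u).
    by rewrite sumr_const card_ord mulr_natl.
  apply: ler_sum => i _; rewrite big_ord1 -sqrtr_sqr ler_wsqrtr // quad1E.
  by rewrite (bigD1 i) //= lerDl sumr_ge0 // => j _; exact: sqr_ge0.
rewrite -[leRHS](sqr_sqrtr (quad1_ge0 u)) lerXn2r ?nnegrE ?sqrtr_ge0 //.
  by rewrite mulr_ge0 // ltW.
rewrite /c ler_pdivrMl ?mulr_gt0 ?ltr0n //; apply: le_trans (N_ub u) _.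
apply: (@le_trans _ _ ((`|C| + 1) * l1norm u)).
  rewrite ler_wpM2r ?l1norm_ge0 //; have := ler_norm C; lra.
by rewrite -mulrA ler_wpM2l // ltW.
Qed.

(** The columns of [M] lie in the unit ball of [N], so the entries of [M] are at
    most 1 in absolute value, and the Leibniz formula has [(n.+1)`!] terms. *)
Lemma inscribed_det_le M : inscribed M -> (\det M) ^+ 2 <= (n.+1)`!%:R ^+ 2.
Proof.
move=> insM; have M1 i j : `|M i j| <= 1.
  have -> : M i j = (M *m delta_mx j (0 : 'I_1)) i 0 by rewrite -colE mxE.
  apply: le_trans (ler_entry_l1norm _ _ _) _; apply: le_trans (N_lb _) _.
  rewrite -(@expr_le1 _ 2) //; apply: le_trans (insM _) _.
  rewrite quad1E (bigD1 j) //= mxE !eqxx expr1n big1 ?addr0 // => k kj.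
  by rewrite mxE (negPf kj) expr0n.
rewrite -[leLHS]real_normK ?num_real // lerXn2r ?nnegrE ?ler0n //.
apply: le_trans (ler_norm_sum _ _ _) _.
rewrite -card_Sn -sumr_const; apply: ler_sum => s _.
rewrite normrM normrX normrN1 expr1n mul1r normr_prod.
by apply: prodr_ile1 => i _; rewrite normr_ge0 M1.
Qed.

(** The convex hull of the ellipsoid of [M] and of the points [M z] and [- M z],
    which lies in the unit ball of [N], contains the ellipsoid of [M S]: with
    [g = S^-1 u], the point [M S u = M S^2 g] is the combination of [M g] and
    [M z] with coefficients [1 - t] and [t <z, g>], and its size is controlled
    by the convexity of the square. *)
Lemma inscribed_update M z t (S : 'M[R]_n.+1) : inscribed M -> N (M *m z) <= 1 ->
  0 <= t <= 1 -> S^T = S -> S *m S = (1 - t)%:M + t *: (z *m z^T) ->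
  S \in unitmx -> inscribed (M *m S).
Proof.
move=> insM Nz /andP[t0 t1] ST SS Su u; pose g := invmx S *m u.
have uE : u = S *m g by rewrite mulKVmx.
have -> : quad 1%:M u = quad (S *m S) g.
  by rewrite uE -quad_congr mulmx1 ST.
have [b zg] : exists b, z^T *m g = b%:M by exists ((z^T *m g) 0 0); exact: mx11_scalar.
have SSg : S *m S *m g = (1 - t) *: g + (t * b) *: z.
  by rewrite SS mulmxDl mul_scalar_mx -scalemxAl -mulmxA zg mul_mx_scalar scalerA.
have -> : quad (S *m S) g = (1 - t) * quad 1%:M g + t * b ^+ 2.
  rewrite /quad -mulmxA SSg mulmxDr -!scalemxAr mulmx1.
  have -> : g^T *m z = b%:M by rewrite -[LHS]trmxK trmx_mul trmxK zg tr_scalar_mx.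
  by rewrite !mxE mulr1n expr2 mulrA.
have Na : N (M *m g) ^+ 2 <= quad 1%:M g := insM g.
have -> : M *m S *m u = (1 - t) *: (M *m g) + (t * b) *: (M *m z).
  by rewrite uE -mulmxA (mulmxA S) SSg mulmxDr -!scalemxAr.
have le1 : N ((1 - t) *: (M *m g) + (t * b) *: (M *m z)) <=
    (1 - t) * N (M *m g) + t * `|b|.
  apply: le_trans (N_D _ _) _; rewrite !N_Z normrM (ger0_norm t0).
  rewrite [`|1 - t|]ger0_norm ?subr_ge0 //.
  by rewrite lerD2l -mulrA ler_wpM2l // ler_piMr.
apply: (@le_trans _ _ (((1 - t) * N (M *m g) + t * `|b|) ^+ 2)).
  by rewrite lerXn2r ?nnegrE // (le_trans (N_ge0 _) le1).
have b2 : `|b| ^+ 2 = b ^+ 2 by rewrite real_normK ?num_real.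
rewrite -b2; apply: (@le_trans _ _ ((1 - t) * N (M *m g) ^+ 2 + t * `|b| ^+ 2)).
  have : 0 <= (1 - t) * t * (N (M *m g) - `|b|) ^+ 2.
    by rewrite mulr_ge0 ?sqr_ge0 // mulr_ge0 // subr_ge0.
  rewrite -subr_ge0 => h; rewrite -subr_ge0; apply: le_trans h _.
  by rewrite le_eqVlt; apply/orP; left; apply/eqP; ring.
by rewrite lerD2r ler_wpM2l // subr_ge0.
Qed.

(** The product is 1 at [t = 0] and its derivative there is [K - n.+1]. Bounding
    the power by Bernoulli's inequality makes a witness explicit. *)
Lemma det_gain_gt1 (K : R) : n.+1%:R < K ->
  exists2 t, 0 < t < 1 & 1 < (1 - t) ^+ n * (1 - t + t * K).
Proof.
move=> nK; have n0 : 0 <= n%:R :> R by rewrite ler0n.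
rewrite -natr1 in nK.
have bern (t : R) k : 0 <= t <= 1 -> 1 - k%:R * t <= (1 - t) ^+ k.
  move=> /andP[t0 t1]; elim: k => [|k IHk]; first by rewrite mul0r subr0.
  rewrite exprS -natr1; apply: le_trans (ler_wpM2l _ IHk); last by rewrite subr_ge0.
  have : 0 <= k%:R * t ^+ 2 by rewrite mulr_ge0 // sqr_ge0.
  move=> h; rewrite -subr_ge0; apply: le_trans h _.
  by rewrite le_eqVlt; apply/orP; left; apply/eqP; ring.
(* Bernoulli's bound exceeds 1 when [n * t * (K - 1) < K - n.+1]. *)
pose t := (K - (n%:R + 1)) / (2 * (n%:R + 1) * K).
have K0 : 0 < K by lra.
have d0 : 0 < 2 * (n%:R + 1) * K by rewrite !mulr_gt0 //; lra.
have t0 : 0 < t by rewrite divr_gt0 // subr_gt0.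
have tE : t * (2 * (n%:R + 1) * K) = K - (n%:R + 1) by rewrite mulfVK // gt_eqF.
have t1 : t < 1 by rewrite ltr_pdivrMr // mul1r; nra.
exists t; first by rewrite t0.
have f0 : 0 < 1 - t + t * K by nra.
apply: lt_le_trans (ler_wpM2r (ltW f0) (bern t n _)); last by rewrite !ltW.
rewrite -subr_gt0.
have -> : (1 - n%:R * t) * (1 - t + t * K) - 1 =
   t * ((K - (n%:R + 1)) - n%:R * t * (K - 1)) by ring.
rewrite mulr_gt0 // -tE subr_gt0.
nra.
Qed.

(** Take an inscribed ellipsoid of almost maximal volume and let [Q] be the
    square of its gauge. If some [x] had [Q x > K * N x ^ 2], then a multiple of
    [x] would lie in the unit ball of [N] and on the boundary of the ellipsoid
    scaled by [sqrt K], and adding it to the ellipsoid would multiply the squared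
    volume by the gain of [det_gain_gt1]. As [K] exceeds the dimension, this gain
    is a fixed factor greater than 1, so that a volume within this factor of the
    supremum is enough for a contradiction. *)
Lemma loewner_john (K : R) : n.+1%:R < K ->
  exists2 Q, posdefmx Q & forall x, N x ^+ 2 <= quad Q x <= K * N x ^+ 2.
Proof.
move=> nK; have [t /andP[t0 t1] gain] := det_gain_gt1 nK.
set g := (1 - t) ^+ n * _ in gain.
have K0 : 0 < K by apply: lt_trans nK; rewrite ltr0n.
have g0 : 0 < g by lra.
pose V : set R := [set (\det M) ^+ 2 | M in inscribed]%classic.
have V_ub d : V d -> d <= (n.+1)`!%:R ^+ 2.
  by move=> [M insM <-]; exact: inscribed_det_le.
have V_has_ub : has_ubound V by exists ((n.+1)`!%:R ^+ 2) => d /V_ub.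
have [M0 insM0 detM0] := inscribed_ex.
have sup0 : 0 < sup V by apply: lt_le_trans detM0 _; apply: ub_le_sup => //; exists M0.
have [_ [M insM <-] detM] : exists2 d, V d & sup V / g < d.
  apply: sup_gt; first by exists (\det M0 ^+ 2), M0.
  by rewrite ltr_pdivrMr // ltr_pMr.
have Mu : M \in unitmx.
  rewrite unitmxE unitfE -sqrf_eq0 gt_eqF //; apply: lt_trans detM.
  by rewrite divr_gt0.
pose Q := (invmx M)^T *m 1%:M *m invmx M.
have QE x : quad Q x = quad 1%:M (invmx M *m x) by exact: quad_congr.
exists Q.
  split; first by rewrite /Q mulmx1 trmx_mul trmxK.
  move=> x x0; rewrite QE; apply: quad1_gt0.
  by apply: contraNneq x0 => h; rewrite -(mulKVmx Mu x) h mulmx0.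
move=> x; rewrite QE; set z := invmx M *m x.
have xE : x = M *m z by rewrite mulKVmx.
apply/andP; split; first by rewrite xE; exact: insM.
rewrite leNgt; apply/negP => far.
have z0 : 0 < quad 1%:M z by apply: le_lt_trans far; rewrite mulr_ge0 ?sqr_ge0 // ltW.
(* Scaling [x] so that the preimage under [M] has squared norm exactly [K]
   makes the gain equal to [g]. *)
pose c := Num.sqrt (K / quad 1%:M z); pose y := c *: z.
have c2 : c ^+ 2 = K / quad 1%:M z by rewrite sqr_sqrtr // divr_ge0 // ltW.
have qy : quad 1%:M y = K by rewrite quadZr c2 mulfVK // gt_eqF.
have Ny : N (M *m y) <= 1.
  rewrite -(@expr_le1 _ 2) // -scalemxAr N_Z exprMn -xE real_normK ?num_real //.
  by rewrite c2 mulrAC ler_pdivrMr // mul1r ltW.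
have y0 : 0 < quad 1%:M y by rewrite qy.
have tI : 0 <= t <= 1 by rewrite !ltW.
have [S ST SS] := rank1_update_sqrt tI y0.
have detS : \det S ^+ 2 = g.
  rewrite expr2 -det_mulmx SS scalemxAl det_scalarD_rank1 ?subr_eq0 ?gt_eqF //.
  by rewrite /g -qy -scalemxAr mxE /quad mulmx1.
have Su : S \in unitmx by rewrite unitmxE unitfE -sqrf_eq0 detS gt_eqF.
have insMS := inscribed_update insM Ny tI ST SS Su.
have : \det (M *m S) ^+ 2 <= sup V by apply: ub_le_sup => //; exists (M *m S).
by rewrite det_mulmx exprMn detS -ler_pdivlMr // leNgt detM.
Qed.

End LoewnerJohn.

(** * A norm adapted to a growth rate *)

Section ExtremalNorm.
Context {R : realType} {n m : nat}.
Variables (A : 'I_m -> 'M[R]_n) (q : R).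
Hypotheses (q0 : 0 < q) (Aq : word_growth A q).
Local Open Scope classical_set_scope.
Local Open Scope ring_scope.

Let orbit_norms (x : 'cV[R]_n) : set R :=
  range (fun s => l1norm (mxword A s *m x) / q ^+ size s).

(** The norm of Rota and Strang: as the supremum runs over words of all
    lengths, applying a letter multiplies it by at most [q]. *)
Definition growth_norm x : R := sup (orbit_norms x).

Lemma growth_norm_ub : exists C, forall x, ubound (orbit_norms x) (C * l1norm x).
Proof.
have [C AC] := Aq; exists C => x _ [s _ <-].
rewrite ler_pdivrMr ?exprn_gt0 // mulrAC; apply: le_trans (ler_l1normM _ _) _.
by rewrite ler_wpM2r ?l1norm_ge0.
Qed.

Let orbit_norms_neq0 x : orbit_norms x !=set0.
Proof. by exists (l1norm (mxword A [::] *m x) / q ^+ 0), [::]. Qed.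

Lemma growth_norm_ge_word x s :
  l1norm (mxword A s *m x) <= growth_norm x * q ^+ size s.
Proof.
rewrite -ler_pdivrMr ?exprn_gt0 //; apply: ub_le_sup; last by exists s.
by have [C bC] := growth_norm_ub; exists (C * l1norm x).
Qed.

Lemma growth_norm_le x c : (forall s, l1norm (mxword A s *m x) <= c * q ^+ size s) ->
  growth_norm x <= c.
Proof.
move=> h; apply: ge_sup => // _ [s _ <-].
by rewrite ler_pdivrMr ?exprn_gt0.
Qed.

Lemma growth_norm_l1norm : exists C, forall x, growth_norm x <= C * l1norm x.
Proof. by have [C bC] := growth_norm_ub; exists C => x; exact: ge_sup. Qed.

Lemma l1norm_le_growth_norm x : l1norm x <= growth_norm x.
Proof. by have := growth_norm_ge_word x [::]; rewrite mul1mx mulr1. Qed.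

Lemma growth_normD x y : growth_norm (x + y) <= growth_norm x + growth_norm y.
Proof.
apply: growth_norm_le => s; rewrite mulmxDr mulrDl.
by apply: le_trans (ler_l1normD _ _) _; rewrite lerD ?growth_norm_ge_word.
Qed.

Lemma growth_normZ c x : growth_norm (c *: x) = `|c| * growth_norm x.
Proof.
have le d y : growth_norm (d *: y) <= `|d| * growth_norm y.
  apply: growth_norm_le => s; rewrite -scalemxAr l1normZ -mulrA.
  by rewrite ler_wpM2l ?growth_norm_ge_word.
apply/le_anti; rewrite le /=; have [->|c0] := eqVneq c 0.
  by rewrite normr0 mul0r (le_trans _ (l1norm_le_growth_norm _)) ?l1norm_ge0.
rewrite -ler_pdivlMl ?normr_gt0 // -normfV.
by rewrite -{1}[x]scale1r -(mulVf c0) -scalerA le.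
Qed.

Lemma growth_norm_word s x : growth_norm (mxword A s *m x) <= q ^+ size s * growth_norm x.
Proof.
apply: growth_norm_le => t; rewrite mulmxA -mxword_cat mulrAC -exprD mulrC -size_cat.
exact: growth_norm_ge_word.
Qed.

End ExtremalNorm.

(** * The de Bruijn graph *)

Section DeBruijn.
Variables m p : nat.

(** A node announces the next [p] letters to be read, so an edge discards the
    letter that it reads and appends an arbitrary one. *)
Definition debruijn : lgraph m :=
  @LGraph m (p.-tuple 'I_m)
    [set e : p.-tuple 'I_m * 'I_m * p.-tuple 'I_m |
      e.1.1 == take p (e.1.2 :: e.2) :> seq 'I_m].

Lemma mem_debruijn (i : debruijn) a (j : debruijn) :
  ((i, a, j) \in edges debruijn) =
  (tval i == take p (a :: tval j)).
Proof. by rewrite inE. Qed.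

Definition debruijn_pred (a : 'I_m) (j : p.-tuple 'I_m) : p.-tuple 'I_m :=
  [tuple of belast a j].

Lemma take_cons_belast (a : 'I_m) (j : p.-tuple 'I_m) :
  take p (a :: j) = belast a j.
Proof.
by rewrite lastI -cats1 take_cat size_belast size_tuple ltnn subnn take0 cats0.
Qed.

Lemma card_debruijn_edges : #|edges debruijn| = (m ^ p.+1)%N.
Proof.
have -> : edges debruijn =
    [set (debruijn_pred e.1 e.2, e.1, e.2) | e in [set: 'I_m * p.-tuple 'I_m]].
  apply/setP => -[[i a] j]; rewrite mem_debruijn take_cons_belast.
  apply/eqP/imsetP => [ij|[[b k] _ [-> -> ->]] //].
  exists (a, j); rewrite ?inE //=; congr (_, _, _); exact: val_inj.
rewrite card_imset => [|[a j] [b k] [_ -> ->] //].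
by rewrite cardsT card_prod card_tuple card_ord expnS.
Qed.

(** Along the word [s] the node reached at time [t] announces the letters read
    from time [t] on; past the end of [s] any letter will do. *)
Lemma debruijn_path_complete : path_complete debruijn.
Proof.
move=> k s k0; pose x0 := tnth s (Ordinal k0).
pose v t := [tuple nth x0 s (t + i) | i < p].
have vE t i : (i < p)%N -> nth x0 (v t) i = nth x0 s (t + i).
  by move=> ip; rewrite -(tnth_nth x0 _ (Ordinal ip)) tnth_mktuple.
exists v => t; rewrite mem_debruijn; apply/eqP/(@eq_from_nth _ x0).
  by rewrite size_takel ?size_tuple //= size_tuple.
move=> i; rewrite size_tuple => ip; rewrite nth_take // vE //.
case: i ip => [|i] ip /=; first by rewrite addn0 (tnth_nth x0).
by rewrite vE ?addSnnS // ltnW.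
Qed.

End DeBruijn.

(** * The linear matrix inequalities of the de Bruijn graph *)

Section DeBruijnLMI.
Context {R : realType} {n m : nat}.
Variables (p : nat) (A : 'I_m -> 'M[R]_n) (gamma : R).

(** Every node has, for every letter, an incoming edge with this label. Hence
    each quadratic form, after a step, is bounded by one before the step. *)
Lemma debruijn_max_quad : (0 < m)%N ->
  lmi_feasible (debruijn m p) A gamma -> max_quad_lyapunov A gamma.
Proof.
move=> m0 [P [Ppos PA]].
have card0 : (0 < #|{: p.-tuple 'I_m}|)%N by rewrite card_tuple card_ord expn_gt0 m0.
have cardE := prednK card0.
pose Q (i : 'I_#|{: p.-tuple 'I_m}|.-1.+1) := P (enum_val (cast_ord cardE i)).
have le_max j x : quad (P j) x <= max_quad Q x.
  apply/bigmax_geP; right; exists (cast_ord (esym cardE) (enum_rank j)) => //.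
  by rewrite /Q cast_ordKV enum_rankK.
exists _, Q; split=> [i|a x]; first exact: Ppos.
have decr j : quad (P j) (gamma *: (A a *m x)) <= max_quad Q x.
  apply: le_trans (le_max (debruijn_pred a j) x).
  have [|_ /(_ x)] := PA (debruijn_pred a j) a j.
    by rewrite mem_debruijn take_cons_belast.
  by rewrite quadDl quadNl quadZl quad_congr subr_ge0 quadZr.
by apply/bigmax_leP; split => [|i _]; exact: decr.
Qed.

(** A common quadratic Lyapunov function [Q] of the words of length [p.+1] is
    spread over the nodes by adding up its values along the announced letters.
    Passing to the next node shifts the sum: it loses the term of the empty
    word, [Q] itself, and gains the term of a word of length [p.+1], which is at
    most [Q]. *)
Lemma debruijn_feasible (gamma0 : 0 < gamma) (Q : 'M[R]_n) : posdefmx Q ->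
  (forall w, size w = p.+1 -> forall x,
    gamma ^+ (2 * p.+1) * quad Q (mxword A w *m x) <= quad Q x) ->
  lmi_feasible (debruijn m p) A gamma.
Proof.
move=> Qpos QA; have [QT Qgt0] := Qpos.
pose F (w : seq 'I_m) k :=
  gamma ^+ (2 * k) *: ((mxword A (take k w))^T *m Q *m mxword A (take k w)).
have FT w k : (F w k)^T = F w k.
  rewrite /F; set W := mxword _ _.
  by rewrite linearZ /= !trmx_mul trmxK QT mulmxA.
pose P (i : p.-tuple 'I_m) := \sum_(k < p.+1) F i k.
have PT i : (P i)^T = P i by rewrite /P linear_sum; apply: eq_bigr => k _; exact: FT.
have quadF w k x :
    quad (F w k) x = gamma ^+ (2 * k) * quad Q (mxword A (take k w) *m x).
  by rewrite quadZl quad_congr.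
have quadP i x : quad (P i) x = \sum_(k < p.+1) quad (F i k) x by exact: quad_sum.
exists P; split=> [i|i a j].
  split=> // x x0; rewrite quadP big_ord_recl ltr_pwDl //.
    by rewrite quadF muln0 mul1r take0 mul1mx Qgt0.
  apply: sumr_ge0 => k _; rewrite quadF mulr_ge0 ?posdef_ge0 //.
  by rewrite exprn_ge0 // ltW.
rewrite mem_debruijn => /eqP ij; split.
  rewrite linearB /= PT linearZ /=; congr (_ - _ *: _).
  by rewrite !trmx_mul trmxK PT mulmxA.
move=> x; rewrite quadDl quadNl quadZl quad_congr subr_ge0 !quadP mulr_sumr.
pose G k := quad (F (a :: j) k) x.
have -> : \sum_(k < p.+1) quad (F i k) x = G 0%N + \sum_(1 <= k < p.+1) G k.
  rewrite -big_ltn // big_mkord; apply: eq_bigr => k _.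
  by rewrite /G !quadF ij take_takel // -ltnS.
have -> : \sum_(k < p.+1) gamma ^+ 2 * quad (F j k) (A a *m x) =
    \sum_(1 <= k < p.+1) G k + G p.+1.
  rewrite -big_nat_recr // big_add1 big_mkord; apply: eq_bigr => k _.
  by rewrite /G !quadF /= mxword_cons mulmxA mulrA -exprD mulnS.
rewrite addrC lerD2r /G !quadF muln0 mul1r take0 mul1mx; apply: QA.
by rewrite size_takel //= size_tuple.
Qed.

End DeBruijnLMI.

(** * Bounds on the joint spectral radius *)

Section Bounds.
Context {R : realType} {n m : nat}.
Variables (p : nat) (A : 'I_m -> 'M[R]_n) (nrm : 'M[R]_n -> R).
Hypotheses (m0 : (0 < m)%N) (n0 : (0 < n)%N) (nrmP : is_mxnorm nrm).

Let kappa : R := n%:R `^ (2 * p.+1)%:R^-1.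

Let kappa0 : 0 < kappa. Proof. by rewrite powR_gt0 // ltr0n. Qed.

(** The ellipsoid of the norm adapted to a rate between [jsr] and [rho / kappa]
    is a common quadratic Lyapunov function for the words of length [p.+1]. *)
Lemma debruijn_feasible_of_jsr rho : kappa * jsr nrm A < rho ->
  lmi_feasible (debruijn m p) A rho^-1.
Proof.
move=> jsr_lt; have kN0 : kappa != 0 by rewrite gt_eqF.
have rho0 : 0 < rho.
  by apply: le_lt_trans jsr_lt; rewrite mulr_ge0 ?(ltW kappa0) ?jsr_ge0.
have jsr_lt' : jsr nrm A < rho / kappa by rewrite ltr_pdivlMr // mulrC.
have [q jsr_q q_rho] : exists2 q, jsr nrm A < q & q < rho / kappa.
  by exists ((jsr nrm A + rho / kappa) / 2); lra.
have q0 : 0 < q by apply: le_lt_trans jsr_q; exact: jsr_ge0.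
have Aq := growth_of_jsr_lt nrmP jsr_q.
(* With this [K], the bound [K * q ^+ e] on the growth of [Q] along a word of
   length [p.+1] is exactly [rho ^+ e]. *)
pose e := (2 * p.+1)%N; pose K := (rho / q) ^+ e.
have nK : n%:R < K.
  have -> : n%:R = kappa ^+ e.
    by rewrite -powR_mulrn ?(ltW kappa0) // -powRrM mulVf ?powRr1 ?pnatr_eq0.
  rewrite ltrXn2r ?nnegrE ?(ltW kappa0) ?divr_ge0 ?(ltW rho0) ?(ltW q0) //.
  by rewrite ltr_pdivlMr // mulrC -ltr_pdivlMr.
have [C N_ub] := growth_norm_l1norm q0 Aq.
have [Q Qpos QN] : exists2 Q : 'M[R]_n, posdefmx Q & forall x,
    growth_norm A q x ^+ 2 <= quad Q x <= K * growth_norm A q x ^+ 2.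
  case: n A n0 nK q0 Aq C N_ub => // n' A' _ nK q0' Aq C N_ub.
  exact: (loewner_john (growth_normD q0' Aq) (growth_normZ q0' Aq)
            (l1norm_le_growth_norm q0' Aq) N_ub nK).
apply: (debruijn_feasible _ Qpos); first by rewrite invr_gt0.
move=> w wp x; have /andP[QN_lb _] := QN x; apply: le_trans QN_lb.
have /andP[_ Qw] := QN (mxword A w *m x).
rewrite exprVn ler_pdivrMl ?exprn_gt0 //; apply: le_trans Qw _.
have Kq : K * q ^+ e = rho ^+ e by rewrite /K -exprMn mulfVK // gt_eqF.
have -> : rho ^+ e * growth_norm A q x ^+ 2 =
    K * (q ^+ p.+1 * growth_norm A q x) ^+ 2.
  by rewrite -Kq exprMn -mulrA -exprM (mulnC p.+1).
have K0 : 0 <= K by rewrite exprn_ge0 // divr_ge0 // ltW.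
have N0 y : 0 <= growth_norm A q y.
  exact: le_trans (l1norm_ge0 _) (l1norm_le_growth_norm q0 Aq y).
rewrite ler_wpM2l // lerXn2r ?nnegrE ?N0 ?mulr_ge0 ?exprn_ge0 ?(ltW q0) //.
by rewrite -wp; exact: growth_norm_word.
Qed.

Let feasible_rates : set R := [set gamma^-1 | gamma in
  [set gamma : R | 0 < gamma /\ lmi_feasible (debruijn m p) A gamma]]%classic.

Let feasible_rates_mem rho : kappa * jsr nrm A < rho -> feasible_rates rho.
Proof.
move=> h; exists rho^-1; last by rewrite invrK.
split; last exact: debruijn_feasible_of_jsr.
rewrite invr_gt0; apply: le_lt_trans h; rewrite mulr_ge0 ?jsr_ge0 //.
exact: ltW.
Qed.

Lemma rho_hat_le_jsr : kappa^-1 * rho_hat (debruijn m p) A <= jsr nrm A.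
Proof.
rewrite ler_pdivrMl // leNgt; apply/negP => gap.
pose rho := (kappa * jsr nrm A + rho_hat (debruijn m p) A) / 2.
have /feasible_rates_mem : kappa * jsr nrm A < rho by rewrite /rho; lra.
have lb : has_lbound feasible_rates.
  by exists 0 => _ [gamma [gamma0 _] <-]; rewrite invr_ge0 ltW.
move=> /(ge_inf lb); rewrite -/(rho_hat _ _) /rho; lra.
Qed.

Lemma jsr_le_rho_hat : jsr nrm A <= rho_hat (debruijn m p) A.
Proof.
apply: lb_le_inf.
  by exists (kappa * jsr nrm A + 1); apply: feasible_rates_mem; rewrite ltrDl.
move=> _ [gamma [gamma0 feas] <-]; apply: jsr_le_growth; rewrite ?invr_gt0 //.
by apply: max_quad_lyapunov_growth => //; exact: debruijn_max_quad m0 feas.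
Qed.

End Bounds.

(* "Explicit" is rendered by letting G depend on m and l only: the same graph
   serves every dimension n and every family A of m matrices. *)
Theorem theorem6p1 (R : realType) (m l : nat) (hm : (0 < m)%N) (hl : (0 < l)%N) :
  exists G : lgraph m,
    [/\ path_complete G,
        #|node G| = (m ^ (l - 1))%N,
        #|edges G| = (m ^ l)%N
      & forall (n : nat) (A : 'I_m -> 'M[R]_n), (0 < n)%N ->
          lmi_implies_max_quad G A /\
          forall nrm : 'M[R]_n -> R, is_mxnorm nrm ->
            (n%:R `^ ((2 * l)%:R)^-1)^-1 * rho_hat G A <= jsr nrm A /\
            jsr nrm A <= rho_hat G A].
Proof.
case: l hl => // p _; exists (debruijn m p); split.
- exact: debruijn_path_complete.
- by rewrite /= card_tuple card_ord subn1.
- exact: card_debruijn_edges.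
move=> n A n0; split=> [gamma gamma0|nrm nrmP]; first exact: debruijn_max_quad.
by split; [exact: rho_hat_le_jsr | exact: jsr_le_rho_hat].
Qed.
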